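(* For every real symmetric positive-semidefinite matrix $C$ of order $n$ and every integer $0<s<n$, $$\lim_{\gamma\to 0^+}\operatorname{linx}(C,s;\gamma)=+\infty.$$ If, further, $s<\operatorname{rank}(C)$, then $$\lim_{\gamma\to+\infty}\operatorname{linx}(C,s;\gamma)=+\infty.$$
   Context: Notation: $\mathbf{e}$ is the all-ones vector in $\mathbb{R}^n$; $\operatorname{Diag}(x)$ is the diagonal matrix with diagonal $x$; $\operatorname{ldet}$ is the natural logarithm of the determinant (with value $-\infty$ if the determinant is $0$). For integers $0<s<n$, $P(n,s):=\{x\in\mathbb{R}^n:\mathbf{e}^\top x=s,\ 0\le x\le\mathbf{e}\}$. For a real symmetric positive-semidefinite matrix $C$ of order $n$ and $\gamma>0$, the scaled linx bound is $$\operatorname{linx}(C,s;\gamma):=\max\left\{\tfrac12\Big(\operatorname{ldet}\big(\gamma C\operatorname{Diag}(x)C+\operatorname{Diag}(\mathbf{e}-x)\big)-s\log\gamma\Big): x\in P(n,s)\right\}.$$ *)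

(* Defs.v *)
From HB Require Import structures.
From mathcomp Require Import all_boot all_order all_fingroup all_algebra.
From mathcomp Require Import all_classical all_reals all_analysis.

Set Implicit Arguments.
Unset Strict Implicit.
Unset Printing Implicit Defensive.

Import Order.TTheory GRing.Theory Num.Theory.
Import numFieldNormedType.Exports.

Local Open Scope classical_set_scope.
Local Open Scope ring_scope.

(* Vectors of R^n are row vectors, as expected by [diag_mx]. *)

Definition psdmx (R : realType) (n : nat) (C : 'M[R]_n) : Prop :=
  C \is symmetricmx /\ forall v : 'rV[R]_n, 0 <= (v *m C *m v^T) 0 0.

(* [lne] sends every nonpositive real to -oo. *)
Definition ldet (R : realType) (n : nat) (A : 'M[R]_n) : \bar R :=
  lne (\det A)%:E.

Definition hypersimplex (R : realType) (n s : nat) : set 'rV[R]_n :=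
  [set x | \sum_(i < n) x 0 i = s%:R /\ forall i, 0 <= x 0 i <= 1].

Arguments hypersimplex : clear implicits.

Definition linx_mx (R : realType) (n : nat) (C : 'M[R]_n) (gamma : R)
    (x : 'rV[R]_n) : 'M[R]_n :=
  gamma *: (C *m diag_mx x *m C) + diag_mx (const_mx 1 - x).

Definition linx_obj (R : realType) (n : nat) (C : 'M[R]_n) (s : nat)
    (gamma : R) (x : 'rV[R]_n) : \bar R :=
  ((2^-1)%:E * (ldet (linx_mx C gamma x) - (s%:R * ln gamma)%:E))%E.

(* The maximum is written as a supremum; [linx_attained] below shows that it is
   attained. *)
Definition linx (R : realType) (n : nat) (C : 'M[R]_n) (s : nat) (gamma : R) :
    \bar R :=
  ereal_sup [set linx_obj C s gamma x | x in hypersimplex R n s].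

Lemma le_lne_EFin (R : realType) (a b : R) :
  a <= b -> (lne a%:E <= lne b%:E)%E.
Proof.
move=> ab; case: (leP a 0) => a0.
  by rewrite [X in (X <= _)%E]le0_lneNy ?lee_fin// leNye.
by rewrite !lne_EFin ?(lt_le_trans a0)// lee_fin ler_ln// posrE
  ?(lt_le_trans a0).
Qed.

Lemma le_linx_obj (R : realType) n (C : 'M[R]_n) s g (x y : 'rV[R]_n) :
  \det (linx_mx C g x) <= \det (linx_mx C g y) ->
  (linx_obj C s g x <= linx_obj C s g y)%E.
Proof.
move=> xy; rewrite /linx_obj lee_pmul2l ?lte_fin ?invr_gt0//.
by apply: leeB => //; exact: le_lne_EFin.
Qed.

Lemma continuous_sum_fin (R : realType) (T : topologicalType) (I : Type)
    (r : seq I) (F : I -> T -> R) :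
  (forall i, continuous (F i)) -> continuous (fun x => \sum_(i <- r) F i x).
Proof.
move=> cF; elim: r => [|i r IH].
  rewrite (_ : (fun _ => _) = (fun=> 0)); first by move=> x; exact: cvg_cst.
  by apply/funext => x; rewrite big_nil.
rewrite (_ : (fun _ => _) = (fun x => F i x + \sum_(j <- r) F j x)).
  by move=> x; apply: cvgD; [exact: cF|exact: IH].
by apply/funext => x; rewrite big_cons.
Qed.

Lemma continuous_prod_fin (R : realType) (T : topologicalType) (I : Type)
    (r : seq I) (F : I -> T -> R) :
  (forall i, continuous (F i)) -> continuous (fun x => \prod_(i <- r) F i x).
Proof.
move=> cF; elim: r => [|i r IH].
  rewrite (_ : (fun _ => _) = (fun=> 1)); first by move=> x; exact: cvg_cst.
  by apply/funext => x; rewrite big_nil.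
rewrite (_ : (fun _ => _) = (fun x => F i x * \prod_(j <- r) F j x)).
  by move=> x; apply: cvgM; [exact: cF|exact: IH].
by apply/funext => x; rewrite big_cons.
Qed.

Lemma continuous_det_linx_mx (R : realType) n (C : 'M[R]_n) g :
  continuous (fun x : 'rV[R]_n => \det (linx_mx C g x)).
Proof.
have cD (f h : 'rV[R]_n -> R) : continuous f -> continuous h ->
    continuous (fun x => f x + h x).
  by move=> cf ch x; exact: (@continuousD _ _ _ f h x (cf x) (ch x)).
have cM (f h : 'rV[R]_n -> R) : continuous f -> continuous h ->
    continuous (fun x => f x * h x).
  by move=> cf ch x; exact: (@continuousM _ _ f h x (cf x) (ch x)).
have cC (a : R) : continuous (fun _ : 'rV[R]_n => a) by exact: cst_continuous.
have cX j : continuous (fun x : 'rV[R]_n => x 0 j) by exact: coord_continuous.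
have E (i k : 'I_n) (y : 'rV[R]_n) : linx_mx C g y i k =
    g * (\sum_j C i j * y 0 j * C j k) + (1 + (-1) * y 0 i) * (i == k)%:R.
  rewrite !mxE mulN1r mulr_natr; congr (_ * _ + _).
  by apply: eq_bigr => j _; rewrite mul_mx_diag !mxE.
rewrite /determinant; apply: (@continuous_sum_fin _ _ _ _
  (fun (sg : 'S_n) (x : 'rV[R]_n) =>
    (-1) ^+ sg * \prod_i linx_mx C g x i (sg i))) => sg.
apply: (cM) => //; apply: (@continuous_prod_fin _ _ _ _
  (fun i (x : 'rV[R]_n) => linx_mx C g x i (sg i))) => i.
under eq_fun do rewrite E.
apply: (cD _ _ (cM _ _ (cC _) _) (cM _ _ (cD _ _ _ (cM _ _ _ _)) _)) => //.
apply: (@continuous_sum_fin _ _ _ _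
  (fun j (x : 'rV[R]_n) => C i j * x 0 j * C j (sg i))) => j.
exact: (cM _ _ (cM _ _ (cC _) (cX _)) (cC _)).
Qed.

Lemma compact_hypersimplex (R : realType) n s : compact (hypersimplex R n s).
Proof.
have -> : hypersimplex R n s =
    [set x : 'rV[R]_n | forall i, `[0, 1]%classic (x ord0 i)] `&`
    ((fun x : 'rV[R]_n => \sum_(i < n) x 0 i) @^-1` [set s%:R]).
  apply/seteqP; split=> x [].
    by move=> xs x01; split=> // i; rewrite /= in_itv/= x01.
  by move=> x01 xs; split=> // i; move: (x01 i); rewrite /= in_itv.
apply: compact_closedI.
  by apply: (@rV_compact R n (fun=> `[0, 1]%classic)) => i;
    exact: segment_compact.
apply: closed_comp; last exact: closed_eq.
by move=> x _; apply: continuous_sum_fin => i; exact: coord_continuous.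
Qed.

Lemma hypersimplex_nonempty (R : realType) n s :
  (0 < s < n)%N -> hypersimplex R n s !=set0.
Proof.
move=> /andP[s0 sn]; have n0 : 0 < n%:R :> R by rewrite ltr0n (ltn_trans s0).
exists (const_mx (s%:R / n%:R)); split=> [|i].
  under eq_bigr do rewrite mxE.
  by rewrite sumr_const card_ord -[_ *+ _]mulr_natr divfK// gt_eqF.
by rewrite mxE divr_ge0//= ler_pdivrMr// mul1r ler_nat ltnW.
Qed.

Lemma linx_attained (R : realType) n (C : 'M[R]_n) s gamma :
  (0 < s < n)%N ->
  exists2 x, hypersimplex R n s x &
    linx C s gamma = linx_obj C s gamma x /\
    forall y, hypersimplex R n s y ->
      (linx_obj C s gamma y <= linx_obj C s gamma x)%E.
Proof.
move=> sn.
have [|x] := @EVT_max_rV R n (fun x => \det (linx_mx C gamma x)) _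
  (hypersimplex_nonempty R sn) (@compact_hypersimplex R n s).
  by apply: continuous_subspaceT; exact: continuous_det_linx_mx.
rewrite inE => Px xmax.
have obj_max y : hypersimplex R n s y ->
    (linx_obj C s gamma y <= linx_obj C s gamma x)%E.
  by move=> Py; apply: le_linx_obj; apply: xmax; rewrite inE.
exists x => //; split=> //; apply/eqP; rewrite eq_le; apply/andP; split.
  by apply: ge_ereal_sup => _ [y Py <-]; exact: obj_max.
by apply: ereal_sup_ubound; exists x.
Qed.

(* Main.v *)
Require Import Defs.
From HB Require Import structures.
From mathcomp Require Import all_boot all_order all_algebra ring.
From mathcomp Require Import all_classical all_reals all_analysis.

Set Implicit Arguments.
Unset Strict Implicit.
Unset Printing Implicit Defensive.

Import Order.TTheory GRing.Theory Num.Theory.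
Import numFieldNormedType.Exports.

Local Open Scope classical_set_scope.
Local Open Scope ring_scope.

(** Both limits are forced by a single feasible point, the barycenter
[x = (s/n) e] of the hypersimplex.  Since the objective at [x] is half the
logarithm of [det M / gamma ^ s], where
[M = (1 - s/n) I + gamma (s/n) C^2], it suffices that this quotient tends to
infinity ([cvgey_linx]).

As [gamma] tends to 0, [det M] tends to [(1 - s/n) ^ n > 0], while
[gamma ^ - s] tends to infinity because [s > 0].

As [gamma] tends to infinity, [det M] grows like [gamma ^ r] with
[r = rank C].  To see this, factor [C = F G] with [F] of full column rank and
[G] of full row rank, so that [C^2 = C^T C = G^T (F^T F G)].  Sylvester's
identity [det (1 + X Y) = det (1 + Y X)] ([det_1D_mulmxC]) turns [det M] into
[gamma ^ r] times the determinant of an [r] by [r] matrix which converges to a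
positive multiple of [(F^T F) (G G^T)] ([det_scalar_add_gram]).  Gram matrices
of full-rank matrices have positive determinant ([det_gram_gt0]), so the limit
is positive, and [gamma ^ (r - s)] tends to infinity when [s < r]. *)

(** Both sides are the determinant of the block matrix [1, - X; Y, 1], reduced
    to triangular form by clearing [Y] on its right or on its left. *)
Lemma det_1D_mulmxC (A : comUnitRingType) m n (X : 'M[A]_(m, n))
    (Y : 'M[A]_(n, m)) :
  \det (1%:M + X *m Y) = \det (1%:M + Y *m X).
Proof.
pose P := block_mx 1%:M (- X) Y 1%:M.
have <- : \det P = \det (1%:M + X *m Y).
  have /(congr1 determinant) : P *m block_mx 1%:M 0 (- Y) 1%:M =
      block_mx (1%:M + X *m Y) (- X) 0 1%:M.
    rewrite mulmx_block !(mul1mx, mulmx1, mulmx0, mulNmx, mulmxN, opprK, add0r).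
    by rewrite subrr.
  by rewrite det_mulmx det_lblock det_ublock !det1 !mulr1.
have /(congr1 determinant) : block_mx 1%:M 0 (- Y) 1%:M *m P =
    block_mx 1%:M (- X) 0 (1%:M + Y *m X).
  rewrite mulmx_block !(mul1mx, mulmx1, mul0mx, mulNmx, mulmxN, opprK, addr0).
  by rewrite addNr addrC.
by rewrite det_mulmx det_lblock det_ublock !det1 !mul1r.
Qed.

(** The determinant of a pencil is a polynomial in its parameter. *)
Lemma continuous_det_pencil (R : realType) n (A B : 'M[R]_n) :
  continuous (fun t : R => \det (A + t *: B)).
Proof.
pose p := \det (map_mx polyC A + 'X *: map_mx polyC B).
have -> : (fun t => \det (A + t *: B)) = horner p; last exact: continuous_horner.
apply/funext => t; rewrite -[RHS]/(horner_eval t p) -det_map_mx.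
congr (\det _); apply/matrixP => i j.
by rewrite !mxE /= /horner_eval !hornerE.
Qed.

Lemma cvg_det_pencil0 (R : realType) n (A B : 'M[R]_n) :
  \det (A + t *: B) @[t --> (0 : R)] --> \det A.
Proof.
have := @continuous_det_pencil R n A B 0.
by rewrite /continuous_at scale0r addr0.
Qed.

Lemma mul_row_tr_gt0 (R : realDomainType) n (v : 'rV[R]_n) :
  v != 0 -> 0 < (v *m v^T) 0 0.
Proof.
case/rV0Pn=> i vi; rewrite mxE (bigD1 i)//= ltr_wpDr ?sumr_ge0//; last first.
  by rewrite mxE -expr2 lt_def sqrf_eq0 vi sqr_ge0.
by move=> j _; rewrite mxE -expr2 sqr_ge0.
Qed.

(** On the segment from the identity to [A] every matrix is positive definite,
    hence nonsingular; as the determinant is 1 at the identity, the intermediate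
    value theorem keeps it from becoming nonpositive at [A]. *)
Lemma det_posdef_gt0 (R : realType) n (A : 'M[R]_n) :
  (forall v : 'rV[R]_n, v != 0 -> 0 < (v *m A *m v^T) 0 0) -> 0 < \det A.
Proof.
move=> Apos; pose f (t : R) := \det (1%:M + t *: (A - 1%:M)).
have f0 : f 0 = 1 by rewrite /f scale0r addr0 det1.
have f1 : f 1 = \det A by rewrite /f scale1r addrC subrK.
rewrite -f1 ltNge; apply/negP => f1le0.
(* A root [t] of the determinant in [0, 1] would yield a nonzero [v] on which
   the quadratic form of [(1 - t) I + t A] vanishes. *)
have [|||t] := @IVT R f 0 1 0; rewrite ?ler01//.
- exact/continuous_subspaceT/continuous_det_pencil.
- by rewrite f0 ge_min f1le0 orbT le_max ler01.
rewrite in_itv/= => /andP[t0 t1] /eqP/det0P[v v0 /(congr1 (mulmx^~ v^T))].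
move=> /matrixP/(_ 0 0)/eqP; rewrite mul0mx [X in _ == X]mxE; apply/negP.
rewrite (_ : 1%:M + _ = (1 - t)%:M + t *: A); last first.
  by rewrite scalerBr scale_scalar_mx mulr1 addrCA addrC raddfB/= addrAC.
rewrite mulmxDr mul_mx_scalar -scalemxAr mulmxDl -!scalemxAl.
rewrite mxE [X in X + _]mxE [X in _ + X]mxE gt_eqF//.
(* At [t = 0] only the identity contributes, and strictly. *)
have [->|tn0] := eqVneq t 0.
  by rewrite subr0 mul0r addr0 mul1r mul_row_tr_gt0.
rewrite ltr_wpDl// ?mulr_ge0 ?subr_ge0 ?(ltW (mul_row_tr_gt0 v0))//.
by rewrite mulr_gt0 ?Apos// lt_def tn0.
Qed.

Lemma det_gram_gt0 (R : realType) m n (G : 'M[R]_(m, n)) :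
  row_free G -> 0 < \det (G *m G^T).
Proof.
move=> Gfree; apply: det_posdef_gt0 => v v0.
rewrite mulmxA -mulmxA -trmx_mul mul_row_tr_gt0//.
by rewrite mulmx_free_eq0.
Qed.

Lemma cvgry_mul_pos (R : realType) (T : Type) (F : set_system T) (FF : Filter F)
    (f g : T -> R) (l : R) : 0 < l ->
  f x @[x --> F] --> +oo -> g x @[x --> F] --> l ->
  f x * g x @[x --> F] --> +oo.
Proof.
move=> l0 fy gl; apply/cvgryPge => A.
have l20 : 0 < l / 2 by rewrite divr_gt0.
have gl2 : \forall x \near F, l / 2 <= g x.
  apply: (cvgr_ge l) => //; by rewrite ltr_pdivrMr// ltr_pMr// ltr1n.
have f0 : \forall x \near F, 0 <= f x by move/cvgryPge: fy => /(_ 0).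
have fA : \forall x \near F, A / (l / 2) <= f x by move/cvgryPge: fy; exact.
near=> x; apply: (@le_trans _ _ (f x * (l / 2))).
  by rewrite -ler_pdivrMr//; near: x.
by apply: ler_wpM2l; near: x.
Unshelve. all: by end_near. Qed.

(** The objective is half the logarithm of [det / gamma ^ s]; the exponential
    form of the bound also forces the determinant to be positive, which excludes
    the value -oo. *)
Lemma linx_obj_ge (R : realType) n (C : 'M[R]_n) s (gamma A : R) x :
  0 < gamma -> expR (2 * A) <= \det (linx_mx C gamma x) / gamma ^+ s ->
  (A%:E <= linx_obj C s gamma x)%E.
Proof.
move=> g0 Ag; have gs0 : 0 < gamma ^+ s by rewrite exprn_gt0.
have d0 : 0 < \det (linx_mx C gamma x).
  have := lt_le_trans (expR_gt0 _) Ag.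
  by rewrite pmulr_lgt0// invr_gt0.
rewrite /linx_obj /ldet lne_EFin// -EFinB -EFinM lee_fin ler_pdivlMl//.
rewrite mulr_natl -lnXn// -ln_div ?posrE//.
by rewrite -ler_expR lnK// posrE divr_gt0.
Qed.

(** A fixed feasible point bounds the maximum from below, which is all that
    divergence to +oo requires; the points attaining the maximum may vary with
    [gamma]. *)
Lemma cvgey_linx (R : realType) n (C : 'M[R]_n) s
    (F : set_system R) (FF : Filter F) x :
  hypersimplex R n s x -> (\forall gamma \near F, 0 < gamma) ->
  \det (linx_mx C gamma x) / gamma ^+ s @[gamma --> F] --> +oo ->
  linx C s gamma @[gamma --> F] --> +oo%E.
Proof.
move=> Px F0 /cvgryPge dety; apply/cvgeyPge => A.
have dA := dety (expR (2 * A)).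
near=> gamma; apply: (@le_trans _ _ (linx_obj C s gamma x)).
  by apply: linx_obj_ge; near: gamma.
by apply: ereal_sup_ubound; exists x.
Unshelve. all: by end_near. Qed.

Lemma cvgr_exprVy (R : realType) k : (0 < k)%N ->
  (gamma ^+ k)^-1 @[gamma --> (0 : R)^'+] --> +oo.
Proof.
move=> k0; apply/(@cvgrVy R).
  by near=> x; rewrite exprn_gt0//; near: x; exact: nbhs_right_gt.
rewrite [X in _ --> X](_ : 0 = 0 ^+ k); last by rewrite expr0n gtn_eqF.
exact: (cvg_at_right_filter (@exprn_continuous R k 0)).
Unshelve. all: by end_near. Qed.

Lemma cvgr_expry (R : realType) k : (0 < k)%N ->
  (gamma : R) ^+ k @[gamma --> +oo] --> +oo.
Proof.
move=> k0; apply: ger_cvgy cvg_id; near=> x.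
by rewrite ler_eXnr//; near: x; exact: nbhs_pinfty_ge.
Unshelve. all: by end_near. Qed.

Lemma hypersimplex_barycenter (R : realType) n s : (s <= n)%N -> (0 < n)%N ->
  hypersimplex R n s (const_mx (s%:R / n%:R)).
Proof.
move=> sn n0; have n0' : 0 < n%:R :> R by rewrite ltr0n.
split=> [|i].
  under eq_bigr do rewrite mxE.
  by rewrite sumr_const card_ord -[_ *+ _]mulr_natr divfK// gt_eqF.
by rewrite mxE divr_ge0//= ler_pdivrMr// mul1r ler_nat.
Qed.

Lemma linx_mx_const (R : realType) n (C : 'M[R]_n) (gamma t : R) :
  linx_mx C gamma (const_mx t) = (1 - t)%:M + gamma *: (t *: (C *m C)).
Proof.
rewrite /linx_mx addrC diag_const_mx mul_mx_scalar -scalemxAl.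
by congr (_ + _); apply/matrixP=> i j; rewrite !mxE.
Qed.

(** This isolates the exact order of growth in [t]: the [n] by [n] determinant is
    [t ^ rank C] times a determinant of order [rank C] that stays bounded away
    from 0 as [t] tends to infinity.  It comes from applying Sylvester's identity
    to [C^T C = G^T (F^T F G)]. *)
Lemma det_scalar_add_gram (R : realType) n (C : 'M[R]_n) (a t : R) :
  a != 0 -> t != 0 ->
  let F := col_base C in let G := row_base C in
  \det (a%:M + t *: (C^T *m C)) =
  a ^+ n * (t ^+ \rank C *
    \det (a^-1 *: ((F^T *m F) *m (G *m G^T)) + t^-1 *: 1%:M)).
Proof.
move=> a0 t0 F G.
have -> : a%:M + t *: (C^T *m C) =
    a *: (1%:M + G^T *m ((t / a) *: (F^T *m F *m G))).
  rewrite scalerDr scale_scalar_mx mulr1 -scalemxAr scalerA mulrCA divff// mulr1.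
  by rewrite -[in LHS](mulmx_base C) trmx_mul !mulmxA.
rewrite detZ det_1D_mulmxC; congr (_ * _); rewrite -detZ; congr (\det _).
rewrite scalerDr !scalerA divff// scale1r addrC.
by rewrite -scalemxAl !mulmxA.
Qed.

Theorem theorem3p6 (R : realType) (n : nat) (C : 'M[R]_n) (s : nat) :
  psdmx C -> (0 < s < n)%N ->
  linx C s gamma @[gamma --> 0^'+] --> +oo%E /\
  ((s < \rank C)%N -> linx C s gamma @[gamma --> +oo%R] --> +oo%E).
Proof.
move=> [Csym _] /andP[s0 sn].
have n0 : (0 < n)%N := ltn_trans s0 sn.
have xP := hypersimplex_barycenter R (ltnW sn) n0.
set b : R := s%:R / n%:R in xP.
have b0 : 0 < b by rewrite divr_gt0 ?ltr0n.
have a0 : 0 < 1 - b by rewrite subr_gt0 ltr_pdivrMr ?ltr0n// mul1r ltr_nat.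
clearbody b; split=> [|sr].
  apply: cvgey_linx xP _ _; first exact: nbhs_right_gt.
  under eq_fun do rewrite mulrC.
  apply: (@cvgry_mul_pos _ _ _ _ _ _ ((1 - b) ^+ n)).
  - by rewrite exprn_gt0.
  - exact: cvgr_exprVy.
  under eq_fun do rewrite linx_mx_const.
  by rewrite -det_scalar; apply: cvg_at_right_filter; exact: cvg_det_pencil0.
have Ctr : C^T = C.
  by move: Csym => /(is_hermitianmxP _ _ _); rewrite scale1r map_mx_id.
set r := \rank C in sr.
pose N := (1 - b)^-1 *:
  (((col_base C)^T *m col_base C) *m (row_base C *m (row_base C)^T)).
apply: cvgey_linx xP _ _; first exact: nbhs_pinfty_gt.
(* The pencil is expanded in [g^-1] rather than [g], so that its value at
   [g = +oo] is the nonsingular matrix [N]. *)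
have splitE (g : R) : 0 < g ->
    g ^+ (r - s) * ((1 - b) ^+ n * b ^+ r * \det (N + (g * b)^-1 *: 1%:M)) =
    \det (linx_mx C g (const_mx b)) / g ^+ s.
  move=> g0; rewrite linx_mx_const scalerA -[X in X *m C]Ctr.
  rewrite det_scalar_add_gram ?gt_eqF ?mulr_gt0// exprMn -/N -/r.
  rewrite -[X in g ^+ X * _ ^+ _](subnK (ltnW sr)) exprD.
  by field; rewrite expf_neq0// gt_eqF.
have gy : \forall g \near +oo, 0 < (g : R) by exact: nbhs_pinfty_gt.
apply: (@cvg_trans _ (g ^+ (r - s) * ((1 - b) ^+ n * b ^+ r *
    \det (N + (g * b)^-1 *: 1%:M)) @[g --> +oo])).
  by apply: near_eq_cvg; near=> g; apply: splitE; near: g.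
apply: (@cvgry_mul_pos _ _ _ _ _ _ ((1 - b) ^+ n * b ^+ r * \det N)).
- rewrite !mulr_gt0 ?exprn_gt0// detZ det_mulmx mulr_gt0 ?exprn_gt0 ?invr_gt0//.
  rewrite mulr_gt0 ?det_gram_gt0 ?row_base_free//.
  rewrite -{2}[col_base C]trmxK det_gram_gt0//.
  by rewrite /row_free mxrank_tr; exact: col_base_full.
- by apply: cvgr_expry; rewrite subn_gt0.
apply: cvgMl_tmp.
apply: (@cvg_comp _ _ _ (fun g => (g * b)^-1)
  (fun t => \det (N + t *: 1%:M)) _ (nbhs (0 : R))).
  apply/gtr0_cvgV0; first by near=> g; rewrite mulr_gt0//; near: g.
  exact: gt0_cvgMly.
exact: cvg_det_pencil0.
Unshelve. all: by end_near. Qed.
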